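(* Let $a,b\in\mathbb{R}$ be non-zero and let $\mathfrak{A}$ be the universal C*-algebra generated by projections $A,B,C$ satisfying the relations \[ [A,aB+bC] = [B,aA+C] = 0. \] Then $\mathfrak{A} \cong \mathbb{C}^8 \oplus \mathbb{M}_2$ with \[ A = 1 \oplus 1 \oplus 1 \oplus 1 \oplus 0 \oplus 0 \oplus 0 \oplus 0 \oplus \begin{pmatrix} 1 & 0 \\ 0 & 0 \end{pmatrix}, \] \[ B = 1 \oplus 1 \oplus 0 \oplus 0 \oplus 1 \oplus 1 \oplus 0 \oplus 0 \oplus \begin{pmatrix} t & \sqrt{t(1-t)} \\ \sqrt{t(1-t)} & 1-t \end{pmatrix}, \] \[ C = 1 \oplus 0 \oplus 1 \oplus 0 \oplus 1 \oplus 0 \oplus 1 \oplus 0 \oplus \begin{pmatrix} z & -\frac{a}{b}\sqrt{t(1-t)} \\ -\frac{a}{b}\sqrt{t(1-t)} & 1-z \end{pmatrix}, \] where \[ t = \frac{b^2 + 2a^2b - a^2b^2 - a^2}{4a^2b} \quad\text{and}\quad z = \frac{1}{2} \pm \frac{1}{2} \sqrt{1 - \frac{4a^2}{b^2}t(1-t)} \] for a suitable one of the two choices of sign in $z$.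
   Context: All C*-algebras are unital, and the universal C*-algebra is taken in the unital sense. A projection is an element $P$ with $P=P^*=P^2$. $[X,Y]=XY-YX$. $\mathbb{M}_2$ is the algebra of $2\times2$ complex matrices.
   Formalization: The condition 0 < t < 1 is added: for t outside [0,1] (e.g. a = 1/4, b = 1, t = 4) the displayed B is not self-adjoint, and for t = 0 or 1 the displayed matrices commute, so the stated isomorphism fails. *)

(* Defs.v *)
From HB Require Import structures.
From mathcomp Require Import all_boot all_order all_algebra.
From mathcomp Require Import boolp classical_sets functions filter reals.
From mathcomp Require Import topology normedtype sequences.
From mathcomp Require Import complex.
Set Implicit Arguments.
Unset Strict Implicit.
Unset Printing Implicit Defensive.
Import Order.TTheory GRing.Theory Num.Theory.
Import numFieldNormedType.Exports.
Local Open Scope classical_set_scope.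
Local Open Scope ring_scope.
Local Open Scope complex_scope.

HB.mixin Record Algebra_isStarAlgebra (R : realType) A
    of GRing.Algebra R[i] A := {
  star : A -> A;
  starK : involutive star;
  starD : forall x y : A, star (x + y) = star x + star y;
  starZ : forall (k : R[i]) (x : A), star (k *: x) = k^* *: star x;
  starM : forall x y : A, star (x * y) = star y * star x
}.

#[short(type="starAlgType")]
HB.structure Definition StarAlgebra (R : realType) :=
  {A of GRing.Algebra R[i] A & Algebra_isStarAlgebra R A}.

(* MathComp-Analysis has no join of its normed modules with the algebras of
   ssralg, so the norm is given by a function of its own. *)
HB.mixin Record StarAlgebra_isCStarAlgebra (R : realType) A
    of StarAlgebra R A := {
  cnorm : A -> R;
  cnorm0_eq0 : forall x : A, cnorm x = 0 -> x = 0;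
  cnormD : forall x y : A, cnorm (x + y) <= cnorm x + cnorm y;
  cnormZ : forall (k : R[i]) (x : A), cnorm (k *: x) = Normc.normc k * cnorm x;
  cnormM : forall x y : A, cnorm (x * y) <= cnorm x * cnorm y;
  cnorm_star : forall x : A, cnorm (star x * x) = cnorm x ^+ 2;
  cnorm_complete : forall u : nat -> A,
    (forall e : R, 0 < e -> \forall m & n \near \oo, cnorm (u m - u n) < e) ->
    exists l : A, cnorm (u n - l) @[n --> \oo] --> (0 : R)
}.

#[short(type="cstarAlgType")]
HB.structure Definition CStarAlgebra (R : realType) :=
  {A of StarAlgebra R A & StarAlgebra_isCStarAlgebra R A}.

Section ComplexStar.
Variable R : realType.

HB.instance Definition _ := GRing.Lalgebra_isComAlgebra.Build R[i] R[i].

Let conjK : involutive (fun x : R[i] => x^*).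
Proof. exact: conjcK. Qed.
Let conjD (x y : R[i]) : (x + y)^* = x^* + y^*.
Proof. exact: rmorphD. Qed.
Let conjM (x y : R[i]) : (x * y)^* = y^* * x^*.
Proof. by rewrite mulrC rmorphM. Qed.
Let conjZ (k x : R[i]) : (k *: x)^* = k^* *: x^*.
Proof. exact: rmorphM. Qed.

HB.instance Definition _ :=
  Algebra_isStarAlgebra.Build R R[i] conjK conjD conjZ conjM.

End ComplexStar.

Section MatrixStar.
Variables (R : realType) (n : nat).
Implicit Types X Y : 'M[R[i]]_n.+1.

Definition adjmx X : 'M[R[i]]_n.+1 := map_mx (@conjc R) X^T.

Let adjmxK : involutive adjmx.
Proof. by move=> X; apply/matrixP => i j; rewrite !mxE conjcK. Qed.
Let adjmxD X Y : adjmx (X + Y) = adjmx X + adjmx Y.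
Proof. by rewrite /adjmx linearD/= map_mxD. Qed.
Let adjmxZ (k : R[i]) X : adjmx (k *: X) = k^* *: adjmx X.
Proof. by apply/matrixP => i j; rewrite !mxE rmorphM. Qed.
Let adjmxM X Y : adjmx (X * Y) = adjmx Y * adjmx X.
Proof. by rewrite /adjmx trmx_mul map_mxM. Qed.

HB.instance Definition _ :=
  Algebra_isStarAlgebra.Build R 'M[R[i]]_n.+1 adjmxK adjmxD adjmxZ adjmxM.

End MatrixStar.

Section PairStar.
Variables (R : realType) (A1 A2 : starAlgType R).
Implicit Types x y : (A1 * A2)%type.

Definition star_pair x : (A1 * A2)%type := (star x.1, star x.2).

Let star_pairK : involutive star_pair.
Proof. by case=> x1 x2; rewrite /star_pair !starK. Qed.
Let star_pairD x y : star_pair (x + y) = star_pair x + star_pair y.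
Proof. by rewrite /star_pair !starD. Qed.
Let star_pairZ (k : R[i]) x : star_pair (k *: x) = k^* *: star_pair x.
Proof. by rewrite /star_pair !starZ. Qed.
Let star_pairM x y : star_pair (x * y) = star_pair y * star_pair x.
Proof. by rewrite /star_pair !starM. Qed.

HB.instance Definition _ := Algebra_isStarAlgebra.Build R (A1 * A2)%type
  star_pairK star_pairD star_pairZ star_pairM.

End PairStar.

Section StarAlgebraTheory.
Variable R : realType.

Definition projection (A : starAlgType R) (p : A) : Prop :=
  p = star p /\ star p = p ^+ 2.

Definition commutator (A : starAlgType R) (x y : A) : A := x * y - y * x.

Definition star_morphism (A B : starAlgType R) (f : {lrmorphism A -> B}) : Prop :=
  forall x : A, f (star x) = star (f x).

(* This is isomorphism of C*-algebras when A and B carry C*-norms: those are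
   unique, so a bijective *-homomorphism is isometric. *)
Definition star_isomorphism (A B : starAlgType R) (f : {lrmorphism A -> B}) : Prop :=
  star_morphism f /\ bijective f.

End StarAlgebraTheory.

Section UniversalCStarAlgebra.
Variable R : realType.

Definition closed_star_subalgebra (A : cstarAlgType R) (S : set A) : Prop :=
  [/\ forall (u : nat -> A) (l : A), (forall n, S (u n)) ->
        cnorm (u n - l) @[n --> \oo] --> (0 : R) -> S l,
      S 1,
      forall (k : R[i]) (x y : A), S x -> S y -> S (k *: x + y),
      forall x y : A, S x -> S y -> S (x * y)
    & forall x : A, S x -> S (star x)].

Definition generates (A : cstarAlgType R) (G : set A) : Prop :=
  forall S : set A, closed_star_subalgebra S -> G `<=` S -> S = setT.

Definition projection_relations (a b : R) (V : starAlgType R) (A B C : V) : Prop :=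
  [/\ projection A, projection B, projection C,
      commutator A (a%:C *: B + b%:C *: C) = 0
    & commutator B (a%:C *: A + C) = 0].

(* Morphisms of {lrmorphism _ -> _} preserve 1, as the unital sense of
   universality requires. *)
Definition universal_cstar_algebra (a b : R) (U : cstarAlgType R) (A B C : U) : Prop :=
  [/\ projection_relations a b A B C,
      generates [set A; B; C]
    & forall (V : cstarAlgType R) (A' B' C' : V),
        projection_relations a b A' B' C' ->
        exists f : {lrmorphism U -> V},
          [/\ star_morphism f, f A = A', f B = B' & f C = C'] /\
          forall g : {lrmorphism U -> V},
            [/\ star_morphism g, g A = A', g B = B' & g C = C'] -> g =1 f].

Definition rmx2 (x11 x12 x21 x22 : R) : 'M[R[i]]_2 :=
  \matrix_(i < 2, j < 2)
    (if i == 0 then if j == 0 then x11 else x12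
     else if j == 0 then x21 else x22)%:C.

Definition C8_M2 : Type :=
  (R[i] * R[i] * R[i] * R[i] * R[i] * R[i] * R[i] * R[i] * 'M[R[i]]_2)%type.
HB.instance Definition _ := StarAlgebra.on C8_M2.

End UniversalCStarAlgebra.

(* Main.v *)
Require Import Defs.
From HB Require Import structures.
From mathcomp Require Import all_boot all_order all_algebra.
From mathcomp Require Import boolp classical_sets functions filter reals.
From mathcomp Require Import topology normedtype sequences.
From mathcomp Require Import complex.
From mathcomp Require Import sesquilinear spectral ring lra.
From Stdlib Require Import -(notations) setoid_ring.Ncring setoid_ring.Ncring_tac.
Set Implicit Arguments.
Unset Strict Implicit.
Unset Printing Implicit Defensive.
Import Order.TTheory GRing.Theory Num.Theory.
Import numFieldNormedType.Exports.
Local Open Scope classical_set_scope.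
Local Open Scope ring_scope.
Local Open Scope complex_scope.

(** Write [x, y] for x y - y x and put P = 2A - 1, Q = 2B - 1, S = 2C - 1.  These
    are symmetries (their squares are 1), and the two relations say that [P, Q],
    [Q, S] and [S, P] are scalar multiples of one element d.  A symmetry
    anticommutes with each of its commutators, so P, Q and S all anticommute with
    d; hence d^2 commutes with everything, and so do the anticommutators PQ + QP,
    QS + SQ and SP + PS.  Expanding 4 PS = (2PQ)(2QS) and 4 SP = (2SQ)(2QP) in terms
    of commutators and anticommutators yields a linear equation between two of
    the anticommutators, valid after multiplication by d
    (anticomm_linear_relation); its cyclic permutations determine all three of
    them on d (anticomm_on_commutator).  Together with
    [P, Q]^2 = (PQ + QP)^2 - 4 this gives D^3 = - t(1 - t) D for D = AB - BA.

    So E = - D^2 / (t(1 - t)) is a central projection with DE = D.  Below 1 - E the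
    generators commute, which leaves the 8 products of literals A or 1 - A, B or
    1 - B, C or 1 - C.  Below E, the element v = AB(1 - A) / sqrt(t(1 - t)) satisfies
    v^2 = 0 and v v* v = v, hence it generates a copy of M_2 with unit E, and the
    known anticommutators give the coordinates of B and C in it
    (compress_idempotent).

    These 12 words in A, B, C define a map word_map from C^8 + M_2 to every
    *-algebra that contains such projections.  It is a unital *-homomorphism
    which sends the standard generators to A, B, C (word_hom_exists).  For the
    standard generators of C^8 + M_2 itself it is the identity (word_map_id);
    since *-homomorphisms commute with words, this proves both that C^8 + M_2 is
    generated by the standard generators and that homomorphisms out of it are
    determined on them.  Up to here no norm is involved.  Once C^8 + M_2 carries
    its C*-norm, the operator norm on M_2 and the maximum over the summands, it
    is a universal C*-algebra, and any other one is isomorphic to it by the usual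
    argument with two mutually inverse maps.  Finally
    1 - 2z = a - (a/b)(1 - 2t) fixes z, and z(1 - z) = (a/b)^2 t(1 - t) makes it one
    of the two values 1/2 +- w/2. *)

(** * Normalization in noncommutative rings *)

Section NcringInstance.
Variable V : pzRingType.

#[global] Instance pzRing_Ring_ops :
  @Ring_ops V 0 1 +%R *%R (fun x y => x - y) (@GRing.opp V) eq := {}.

#[global] Instance pzRing_Ring : Ring (Ro := pzRing_Ring_ops).
Proof.
split; try exact _.
- exact: add0r.
- exact: addrC.
- exact: addrA.
- exact: mul1r.
- exact: mulr1.
- exact: mulrA.
- exact: mulrDl.
- by move=> x y z; exact: mulrDr.
- by [].
- exact: addrN.
Qed.

End NcringInstance.

(** Decides identities of noncommutative polynomials with integer coefficients;
    scaled vectors count as atoms.  In the proofs below, rules such as A A = A are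
    used by passing through an expression in which A A is visible. *)
Ltac ncring := rewrite /GRing.exp /=;
  lazymatch goal with |- ?x = ?y => change (Algebra_syntax.equality x y) end;
  non_commutative_ring.

(** * Three symmetries with proportional commutators *)

Section ThreeSymmetries.
Variables (K : fieldType) (V : algType K).
Implicit Types P Q S d : V.

Lemma symmetry_commutator P Q : P * P = 1 ->
  P * (P * Q - Q * P) = - ((P * Q - Q * P) * P).
Proof.
move=> PP; apply/eqP; rewrite -subr_eq0 opprK; apply/eqP.
transitivity (P * P * Q - Q * (P * P)); first by ncring.
by rewrite PP mul1r mulr1 subrr.
Qed.

Lemma symmetry_anticomm (k : K) P Q d : k != 0 -> P * P = 1 ->
  P * Q - Q * P = k *: d -> P * d = - (d * P).
Proof.
move=> k0 PP dPQ; apply: (scalerI k0).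
by rewrite scalerN scalerAr scalerAl -dPQ symmetry_commutator.
Qed.

Variables (P Q S d : V) (al be ga : K).
Hypotheses (al0 : al != 0) (ga0 : ga != 0).
Hypotheses (PP : P * P = 1) (QQ : Q * Q = 1).
Hypotheses (dPQ : P * Q - Q * P = ga *: d) (dQS : Q * S - S * Q = al *: d)
  (dSP : S * P - P * S = be *: d).

Lemma commutator_comm_anticomm : d * (P * Q + Q * P) = (P * Q + Q * P) * d.
Proof.
have Pd := symmetry_anticomm ga0 PP dPQ.
have Qd := symmetry_anticomm al0 QQ dQS.
rewrite mulrDl mulrDr -!mulrA Qd Pd !mulrN [P * (d * Q)]mulrA Pd.
by rewrite [Q * (d * P)]mulrA Qd !mulNr !opprK !mulrA.
Qed.

(** [PQ + QP, S] = P [Q, S] + [Q, S] P - [S, P] Q - Q [S, P], in which P and Q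
    anticommute with the commutators. *)
Lemma third_comm_anticomm : (P * Q + Q * P) * S = S * (P * Q + Q * P).
Proof.
have Pd := symmetry_anticomm ga0 PP dPQ.
have Qd := symmetry_anticomm al0 QQ dQS.
apply/eqP; rewrite -subr_eq0; apply/eqP.
transitivity (P * (Q * S - S * Q) + (Q * S - S * Q) * P
   - ((S * P - P * S) * Q + Q * (S * P - P * S))); first by ncring.
rewrite dQS dSP -!scalerAl -!scalerAr Pd Qd !scalerN.
by rewrite addNr addrN subrr.
Qed.

Lemma symmetry_comm_anticomm : (P * Q + Q * P) * Q = Q * (P * Q + Q * P).
Proof.
by rewrite mulrDl mulrDr -!mulrA QQ mulr1 !mulrA QQ mul1r addrC.
Qed.

End ThreeSymmetries.

Section AnticommutatorRelation.
Variables (K : fieldType) (V : algType K).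
Variables (P Q S d : V) (al be ga : K).
Hypotheses (K2 : 2 != 0 :> K).
Hypotheses (al0 : al != 0) (be0 : be != 0) (ga0 : ga != 0).
Hypotheses (PP : P * P = 1) (QQ : Q * Q = 1) (SS : S * S = 1).
Hypotheses (dPQ : P * Q - Q * P = ga *: d) (dQS : Q * S - S * Q = al *: d)
  (dSP : S * P - P * S = be *: d).

(** With x = PQ + QP and y = QS + SQ, which commute with d and with each other,
    (x + ga d)(y + al d) = (2PQ)(2QS) = 4 PS and
    (y - al d)(x - ga d) = (2SQ)(2QP) = 4 SP.  The difference of the left sides is
    2 d (al x + ga y), that of the right sides is - 4 be d. *)
Lemma anticomm_linear_relation :
  d * (al *: (P * Q + Q * P) + ga *: (Q * S + S * Q)) = - (2 * be) *: d.
Proof.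
have xd := commutator_comm_anticomm al0 ga0 PP QQ dPQ dQS.
have yd := commutator_comm_anticomm be0 al0 QQ SS dQS dSP.
have xS := third_comm_anticomm al0 ga0 PP QQ dPQ dQS dSP.
have xQ := symmetry_comm_anticomm P QQ.
set x := P * Q + Q * P in xd xS xQ *.
have xy : x * (Q * S + S * Q) = (Q * S + S * Q) * x.
  by rewrite mulrDr [RHS]mulrDl !mulrA xQ xS -!mulrA xQ xS.
set y := Q * S + S * Q in yd xy *.
have e : (x + ga *: d) * (y + al *: d) - (y - al *: d) * (x - ga *: d)
         = - ((be *: d) + (be *: d) + (be *: d) + (be *: d)).
  rewrite -dPQ -dQS -dSP /x /y.
  transitivity (P * (Q * Q) * S + P * (Q * Q) * S
     + P * (Q * Q) * S + P * (Q * Q) * S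
     - (S * (Q * Q) * P + S * (Q * Q) * P
     + S * (Q * Q) * P + S * (Q * Q) * P)); first by ncring.
  by rewrite QQ !mulr1; ncring.
have e2 : (x + ga *: d) * (y + al *: d) - (y - al *: d) * (x - ga *: d)
   = 2 *: (d * (al *: x + ga *: y)).
  clearbody x y; rewrite !(mulrDl, mulrDr, mulrN, mulNr, opprK) xy.
  rewrite -!(scalerAl, scalerAr) -xd -yd !scalerA [ga * al]mulrC.
  rewrite -[2]/(1 + 1) scalerDl !scale1r; ncring.
apply: (scalerI K2); rewrite -e2 e scalerA -!scalerDl -scaleNr.
by congr (_ *: _); ring.
Qed.

End AnticommutatorRelation.

Section CommutatorCube.
Variables (K : fieldType) (V : algType K).
Variables (P Q S d : V) (al be ga : K).
Hypotheses (K2 : 2 != 0 :> K).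
Hypotheses (al0 : al != 0) (be0 : be != 0) (ga0 : ga != 0).
Hypotheses (PP : P * P = 1) (QQ : Q * Q = 1) (SS : S * S = 1).
Hypotheses (dPQ : P * Q - Q * P = ga *: d) (dQS : Q * S - S * Q = al *: d)
  (dSP : S * P - P * S = be *: d).

(** The cyclic permutations of the linear relation form a 3 x 3 linear system
    for the anticommutators; the combination be, - ga, al eliminates QS + SQ and
    SP + PS. *)
Lemma anticomm_on_commutator :
  d * (P * Q + Q * P) = (ga ^+ 2 - al ^+ 2 - be ^+ 2) / (al * be) *: d.
Proof.
have e1 := anticomm_linear_relation K2 al0 be0 ga0 PP QQ SS dPQ dQS dSP.
have e2 := anticomm_linear_relation K2 be0 ga0 al0 QQ SS PP dQS dSP dPQ.
have e3 := anticomm_linear_relation K2 ga0 al0 be0 SS PP QQ dSP dPQ dQS.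
have h0 : 2 * (al * be) != 0 by rewrite !mulf_neq0.
apply: (scalerI h0).
rewrite -[LHS](_ : be *: (d * (al *: (P * Q + Q * P) + ga *: (Q * S + S * Q)))
  - ga *: (d * (be *: (Q * S + S * Q) + al *: (S * P + P * S)))
  + al *: (d * (ga *: (S * P + P * S) + be *: (P * Q + Q * P))) = _).
  rewrite e1 e2 e3 !scalerA -scalerBl -scalerDl; congr (_ *: _).
  by field; rewrite al0 be0.
set x := P * Q + Q * P; set y := Q * S + S * Q; set z := S * P + P * S.
clearbody x y z; rewrite !mulrDr -!scalerAr !scalerDr !scalerA.
rewrite [be * ga]mulrC [al * ga]mulrC [be * al]mulrC -[2]/(1+1) mulrDl mul1r scalerDl.
by ncring.
Qed.

Lemma commutator_sqr :
  (ga ^+ 2) *: (d * d) = (P * Q + Q * P) * (P * Q + Q * P) - 4.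
Proof.
rewrite expr2 -scalerA scalerAr scalerAl -dPQ.
transitivity (P * Q * (P * Q) + Q * P * (Q * P)
  - (P * (Q * Q) * P + Q * (P * P) * Q)); first by ncring.
rewrite PP QQ !mulr1 PP QQ.
transitivity ((P * Q + Q * P) * (P * Q + Q * P)
  - (P * (Q * Q) * P + Q * (P * P) * Q) - (1 + 1)); first by ncring.
rewrite PP QQ !mulr1 PP QQ -addrA -opprD; congr (_ - _).
exact: esym (natrD V 2 2).
Qed.

Lemma commutator_cube :
  (ga ^+ 2) *: (d * d * d) =
    (((ga ^+ 2 - al ^+ 2 - be ^+ 2) / (al * be)) ^+ 2 - 4) *: d.
Proof.
rewrite -mulrA scalerAr commutator_sqr mulrBr mulrA anticomm_on_commutator.
rewrite -scalerAl anticomm_on_commutator scalerA -expr2 scalerBl.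
by rewrite mulr_natr -scaler_nat.
Qed.

End CommutatorCube.

(** * Three idempotents with proportional commutators *)

Section ThreeIdempotents.
Variables (K : fieldType) (V : algType K).

Lemma sub_quadruple (x y : V) : (x + x + x + x) - (y + y + y + y) = 4 *: (x - y).
Proof.
rewrite [RHS]scaler_nat !mulrS mulr0n addr0; ncring.
Qed.

Variables (A B C D : V) (al be : K).
Hypotheses (K2 : 2 != 0 :> K) (al0 : al != 0) (be0 : be != 0).
Hypotheses (AA : A * A = A) (BB : B * B = B) (CC : C * C = C).
Hypotheses (dAB : A * B - B * A = D) (dBC : B * C - C * B = al *: D)
  (dCA : C * A - A * C = be *: D).

Let sym (X : V) := X + X - 1.

Let symK (X : V) : X * X = X -> sym X * sym X = 1.
Proof.
move=> XX; transitivity (X * X + X * X + X * X + X * X - X - X - X - X + 1).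
  by rewrite /sym; ncring.
by rewrite XX; ncring.
Qed.

Let symB (X Y : V) : sym X * sym Y - sym Y * sym X = 4 *: (X * Y - Y * X).
Proof. by rewrite -sub_quadruple /sym; ncring. Qed.

Let symD (X Y : V) :
  sym X * sym Y + sym Y * sym X = 4 *: (X * Y + Y * X - X - Y) + 2.
Proof.
rewrite -[2]/(1 + 1) scaler_nat !mulrS mulr0n addr0 /sym; ncring.
Qed.

Let dPQ : sym A * sym B - sym B * sym A = 4 *: D.
Proof. by rewrite symB dAB. Qed.
Let dQS : sym B * sym C - sym C * sym B = (4 * al) *: D.
Proof. by rewrite symB dBC scalerA. Qed.
Let dSP : sym C * sym A - sym A * sym C = (4 * be) *: D.
Proof. by rewrite symB dCA scalerA. Qed.

Let K4 : 4 != 0 :> K.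
Proof. by rewrite (natrM K 2 2) mulf_neq0. Qed.
Let K4al : 4 * al != 0. Proof. by rewrite mulf_neq0. Qed.
Let K4be : 4 * be != 0. Proof. by rewrite mulf_neq0. Qed.

(* The anticommutator of 2X - 1 and 2Y - 1 is 4 (XY + YX - X - Y) + 2. *)
Let solve_sym (X Y : V) (k : K) : D * (sym X * sym Y + sym Y * sym X) = k *: D ->
  D * (X * Y + Y * X - X - Y) = ((k - 2) / 4) *: D.
Proof.
rewrite symD mulrDr -scalerAr => e; apply: (scalerI K4).
rewrite scalerA [4 * _]mulrC divfK// scalerBl -e.
by rewrite mulr_natr -scaler_nat addrK.
Qed.

Lemma commutator_moment_AB : D * (A * B + B * A - A - B) =
  (((1 - al ^+ 2 - be ^+ 2) / (al * be) - 2) / 4) *: D.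
Proof.
apply: solve_sym; rewrite (anticomm_on_commutator K2 K4al K4be K4 (symK AA)
  (symK BB) (symK CC) dPQ dQS dSP).
by congr (_ *: _); field; rewrite al0 be0 K4.
Qed.

Lemma commutator_moment_CA : D * (C * A + A * C - C - A) =
  (((be ^+ 2 - 1 - al ^+ 2) / al - 2) / 4) *: D.
Proof.
apply: solve_sym; rewrite (anticomm_on_commutator K2 K4 K4al K4be (symK CC)
  (symK AA) (symK BB) dSP dPQ dQS).
by congr (_ *: _); field; rewrite al0 K4.
Qed.

Lemma idempotent_commutator_cube : D * D * D =
  ((((1 - al ^+ 2 - be ^+ 2) / (al * be)) ^+ 2 - 4) / 16) *: D.
Proof.
have K16 : 4 ^+ 2 != 0 :> K by rewrite expf_neq0.
apply: (scalerI K16); rewrite (commutator_cube K2 K4al K4be K4 (symK AA)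
  (symK BB) (symK CC) dPQ dQS dSP) scalerA.
congr (_ *: _); field; rewrite al0 be0 K4 /=.
by rewrite (natrM K 4 4) mulf_neq0.
Qed.

Lemma commutator_anticommA : A * D + D * A = D.
Proof.
rewrite -dAB; transitivity (A * A * B - B * (A * A)); first by ncring.
by rewrite AA.
Qed.

Lemma commutator_anticommB : B * D + D * B = D.
Proof.
rewrite -dAB; transitivity (A * (B * B) - B * B * A); first by ncring.
by rewrite BB.
Qed.

Lemma commutator_anticommC : C * D + D * C = D.
Proof.
apply: (scalerI be0); rewrite scalerDr scalerAr scalerAl -dCA.
transitivity (C * C * A - A * (C * C)); first by ncring.
by rewrite CC.
Qed.

End ThreeIdempotents.

Section Corner.
Variables (K : fieldType) (V : algType K).

Lemma anticomm_sqr_comm (X D : V) : X * D + D * X = D -> X * (D * D) = D * D * X.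
Proof.
move=> XD; have e : X * D = D - D * X by apply/esym/eqP; rewrite subr_eq XD.
by rewrite mulrA e mulrBl -[D * X * D]mulrA e mulrBr mulrA opprB addrC subrK.
Qed.

(** Relative to A, the element T is the sum of its four corners.  With
    m = AT + TA - A - T, the diagonal ones are A m + A and - (1 - A) m, so a scalar
    value t - 1 of m on E turns them into t A E and (1 - t)(E - A E); the
    off-diagonal ones are those of the commutator AT - TA. *)
Lemma compress_idempotent (A T E D : V) (k t : K) : A * A = A -> A * E = E * A ->
  D * E = D ->
  (A * T - T * A) * E = k *: D ->
  (A * T + T * A - A - T) * E = (t - 1) *: E ->
  T * E = t *: (A * E) + k *: (A * D) - k *: (D * A) + (1 - t) *: (E - A * E).
Proof.
move=> AA AE DE hD hm.
have {1}-> : T = (A + A - 1) * (A * T + T * A - A - T) + A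
    + A * (A * T - T * A) - (A * T - T * A) * A.
  transitivity (A * A * T + A * A * T + A * T * A + A * T * A - A * A - A * A
    - A * T - A * T - A * T - T * A + A + T + A + A * A * T - A * T * A
    - A * T * A + T * (A * A)).
    by rewrite AA; ncring.
  by ncring.
have hDA : (A * T - T * A) * A * E = k *: (D * A).
  by rewrite -mulrA AE mulrA hD scalerAl.
move: (A * T - T * A) (A * T + T * A - A - T) hD hm hDA => D' m hD hm hDA.
transitivity ((A + A - 1) * (m * E) + A * E + A * (D' * E) - D' * A * E).
  by ncring.
rewrite hm hD hDA -!scalerAr mulrBl mulrDl mul1r.
rewrite !(scalerBl, scalerBr, scalerDr, scale1r).
by ncring.
Qed.

End Corner.

(** * The C*-norm on matrices *)

Local Open Scope sesquilinear_scope.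

Lemma normc_ge0 (R : realType) (x : R[i]) : 0 <= Normc.normc x.
Proof. by case: x => x1 x2; exact: sqrtr_ge0. Qed.

(** Locked, as is the operator norm below: otherwise rewriting with the laws of
    multiplication tries to see a norm as a product by unfolding it. *)
HB.lock Definition vnorm (R : realType) n (u : 'rV[R[i]]_n) : R :=
  complex.Re (sqrtC (dotmx u u)).

Section VectorNorm.
Variables (R : realType) (n : nat).
Implicit Types (u v : 'rV[R[i]]_n).

Lemma vnormE u : (vnorm u)%:C = sqrtC (dotmx u u).
Proof. by rewrite vnorm.unlock RRe_real// ger0_real// sqrtC_ge0 dnorm_ge0. Qed.

Lemma vnorm_sqr u : (vnorm u ^+ 2)%:C = dotmx u u.
Proof. by rewrite rmorphXn/= vnormE sqrtCK. Qed.

Lemma vnorm_ge0 u : 0 <= vnorm u.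
Proof. by rewrite -lecR vnormE sqrtC_ge0 dnorm_ge0. Qed.

Lemma vnorm_eq0 u : vnorm u = 0 -> u = 0.
Proof.
move=> u0; apply/eqP; rewrite -(dnorm_eq0 (@dotmx R[i] n)).
by rewrite /= -vnorm_sqr u0 expr0n.
Qed.

Lemma vnorm0 : vnorm (0 : 'rV[R[i]]_n) = 0.
Proof. by rewrite vnorm.unlock linear0l sqrtC0. Qed.

Lemma vnormD u v : vnorm (u + v) <= vnorm u + vnorm v.
Proof.
rewrite -lecR rmorphD/= !vnormE.
by have [] := triangle_lerif (@dotmx R[i] n) u v.
Qed.

Lemma vnormZ (k : R[i]) u : vnorm (k *: u) = Normc.normc k * vnorm u.
Proof.
apply/eqP; rewrite -(eqrXn2 (ltn0Sn 1)) ?vnorm_ge0 ?mulr_ge0 ?vnorm_ge0 ?normc_ge0//.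
apply/eqP/(@complexI R); rewrite vnorm_sqr exprMn rmorphM/= vnorm_sqr.
by rewrite dnormZ rmorphXn.
Qed.

Lemma cauchy_schwarz u v : Normc.normc (dotmx u v) <= vnorm u * vnorm v.
Proof.
rewrite -lecR rmorphM/= !vnormE.
by have [] := CauchySchwarz_sqrt (@dotmx R[i] n) u v.
Qed.

Lemma vnorm_sum (I : finType) (F : I -> 'rV[R[i]]_n) :
  vnorm (\sum_i F i) <= \sum_i vnorm (F i).
Proof.
elim/big_ind2 : _ => [|x1 x2 y1 y2 h1 h2|//]; first by rewrite vnorm0.
by rewrite (le_trans (vnormD _ _))// lerD.
Qed.

Lemma vnorm_delta j : vnorm (delta_mx 0 j : 'rV[R[i]]_n) = 1.
Proof.
rewrite vnorm.unlock dotmxE trmx_delta map_delta_mx/= mul_delta_mx mxE !eqxx.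
by rewrite sqrtC1.
Qed.

Lemma vnorm_coord u j : Normc.normc (u 0 j) <= vnorm u.
Proof.
have := cauchy_schwarz u (delta_mx 0 j); rewrite vnorm_delta mulr1.
by rewrite dotmxE trmx_delta map_delta_mx/= -colE mxE.
Qed.

End VectorNorm.

(** Matrices act on row vectors from the right.  The norm is the least Lipschitz
    constant; opnorm_le and vnorm_mul are the two halves of this description. *)
HB.lock Definition opnorm (R : realType) n (M : 'M[R[i]]_n) : R :=
  inf [set k : R | 0 <= k /\ forall u, vnorm (u *m M) <= k * vnorm u].

Section OperatorNorm.
Variables (R : realType) (n : nat).
Implicit Types (M N : 'M[R[i]]_n).

Lemma opnorm_le M k : 0 <= k -> (forall u, vnorm (u *m M) <= k * vnorm u) ->
  opnorm M <= k.
Proof.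
move=> k0 Mk; rewrite opnorm.unlock; apply: ge_inf; last by split.
by exists 0 => ? [].
Qed.

Lemma vnorm_mul_entries M u :
  vnorm (u *m M) <= (\sum_i \sum_j Normc.normc (M i j)) * vnorm u.
Proof.
rewrite {1}(row_sum_delta u) mulmx_suml (le_trans (vnorm_sum _))// mulr_suml.
apply: ler_sum => i _; rewrite -scalemxAl -rowE vnormZ mulrC ler_pM//.
- exact: vnorm_ge0.
- exact: normc_ge0.
- rewrite {1}(row_sum_delta (row i M)) (le_trans (vnorm_sum _))//.
  by apply: ler_sum => j _; rewrite vnormZ vnorm_delta mulr1 mxE.
- exact: vnorm_coord.
Qed.

Lemma opnorm_entries M : opnorm M <= \sum_i \sum_j Normc.normc (M i j).
Proof.
apply: opnorm_le; last exact: vnorm_mul_entries.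
by do 2!apply: sumr_ge0 => ? _; exact: normc_ge0.
Qed.

Lemma opnorm_ge0 M : 0 <= opnorm M.
Proof.
rewrite opnorm.unlock; apply: lb_le_inf; last by move=> ? [].
exists (\sum_i \sum_j Normc.normc (M i j)); split; last exact: vnorm_mul_entries.
by do 2!apply: sumr_ge0 => ? _; exact: normc_ge0.
Qed.

Lemma vnorm_mul M u : vnorm (u *m M) <= opnorm M * vnorm u.
Proof.
have [/vnorm_eq0->|u0] := eqVneq (vnorm u) 0; first by rewrite mul0mx vnorm0 mulr0.
have u_gt0 : 0 < vnorm u by rewrite lt_def u0 vnorm_ge0.
rewrite -ler_pdivrMr// opnorm.unlock; apply: lb_le_inf.
  exists (\sum_i \sum_j Normc.normc (M i j)); split; last exact: vnorm_mul_entries.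
  by do 2!apply: sumr_ge0 => ? _; exact: normc_ge0.
by move=> k [_ Mk]; rewrite ler_pdivrMr.
Qed.

Lemma opnorm_coord M i j : Normc.normc (M i j) <= opnorm M.
Proof.
have := vnorm_mul M (delta_mx 0 i); rewrite vnorm_delta mulr1 -rowE.
by apply: le_trans; have := vnorm_coord (row i M) j; rewrite mxE.
Qed.

Lemma opnorm_eq0 M : opnorm M = 0 -> M = 0.
Proof.
move=> M0; apply/matrixP => i j; rewrite mxE; apply: Normc.eq0_normc.
by apply/eqP; rewrite eq_le -{1}M0 opnorm_coord normc_ge0.
Qed.

Lemma opnormD M N : opnorm (M + N) <= opnorm M + opnorm N.
Proof.
apply: opnorm_le => [|u]; first by rewrite addr_ge0 ?opnorm_ge0.
by rewrite mulmxDr mulrDl (le_trans (vnormD _ _))// lerD ?vnorm_mul.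
Qed.

Lemma opnormM M N : opnorm (M *m N) <= opnorm M * opnorm N.
Proof.
apply: opnorm_le => [|u]; first by rewrite mulr_ge0 ?opnorm_ge0.
rewrite mulmxA (le_trans (vnorm_mul _ _))// [opnorm M * _]mulrC -mulrA.
by rewrite ler_wpM2l ?opnorm_ge0// vnorm_mul.
Qed.

Lemma opnormZ_le (k : R[i]) M : opnorm (k *: M) <= Normc.normc k * opnorm M.
Proof.
apply: opnorm_le => [|u]; first by rewrite mulr_ge0 ?normc_ge0 ?opnorm_ge0.
by rewrite -scalemxAr vnormZ -mulrA ler_wpM2l ?normc_ge0// vnorm_mul.
Qed.

Lemma opnormZ (k : R[i]) M : opnorm (k *: M) = Normc.normc k * opnorm M.
Proof.
apply/eqP; rewrite eq_le opnormZ_le/=.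
have [->|k0] := eqVneq k 0; first by rewrite Normc.normc0 mul0r opnorm_ge0.
have nk0 : 0 < Normc.normc k.
  by rewrite lt_def normc_ge0 andbT; apply: contraNneq k0 => /Normc.eq0_normc ->.
rewrite -ler_pdivlMl// -Normc.normcV -[in leLHS](scalerK k0 M).
exact: opnormZ_le.
Qed.

(** |u M|^2 = <u M M*, u> <= |u M M*| |u|, by the Cauchy-Schwarz inequality. *)
Lemma opnorm_sqr_le M : opnorm M ^+ 2 <= opnorm (M *m M ^t*).
Proof.
rewrite -[leRHS]sqr_sqrtr ?opnorm_ge0// ler_sqr ?nnegrE ?opnorm_ge0 ?sqrtr_ge0//.
apply: opnorm_le => [|u]; first exact: sqrtr_ge0.
rewrite -ler_sqr ?nnegrE ?vnorm_ge0 ?mulr_ge0 ?vnorm_ge0 ?sqrtr_ge0//.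
rewrite exprMn sqr_sqrtr ?opnorm_ge0//.
have -> : vnorm (u *m M) ^+ 2 = Normc.normc (dotmx (u *m (M *m M ^t*)) u).
  apply: (@complexI R); rewrite vnorm_sqr -[RHS]/(`|dotmx (u *m (M *m M ^t*)) u|).
  have -> : dotmx (u *m (M *m M ^t*)) u = dotmx (u *m M) (u *m M).
    by rewrite !dotmxE trmx_mul map_mxM/= !mulmxA.
  by rewrite ger0_norm// dnorm_ge0.
rewrite (le_trans (cauchy_schwarz _ _))// expr2 mulrA.
by rewrite ler_wpM2r ?vnorm_ge0// vnorm_mul.
Qed.

(** From |M|^2 <= |M M*| <= |M| |M*|. *)
Lemma opnorm_adj_le M : opnorm M <= opnorm (M ^t*).
Proof.
have [M0|M0] := eqVneq (opnorm M) 0; first by rewrite M0 opnorm_ge0.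
have M_gt0 : 0 < opnorm M by rewrite lt_def M0 opnorm_ge0.
rewrite -(ler_pM2l M_gt0) -expr2 (le_trans (opnorm_sqr_le _))//.
exact: opnormM.
Qed.

Lemma opnorm_adj M : opnorm (M ^t*) = opnorm M.
Proof.
by apply/eqP; rewrite eq_le opnorm_adj_le andbT -{2}(trmxCK M) opnorm_adj_le.
Qed.

Lemma opnorm_cstar M : opnorm (M ^t* *m M) = opnorm M ^+ 2.
Proof.
have := opnorm_sqr_le (M ^t*); rewrite trmxCK opnorm_adj => le_sqr.
apply/eqP; rewrite eq_le le_sqr andbT expr2 -[X in _ <= X * _]opnorm_adj.
exact: opnormM.
Qed.

End OperatorNorm.

(** * Complex numbers, matrices and direct sums are C*-algebras *)

(** A norm squeezed between the largest and the sum of finitely many real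
    coordinates inherits completeness from the reals. *)
Lemma complete_from_coordinates (R : realType) (V : zmodType) (N : V -> R)
    (I : finType) (c : I -> V -> R) (build : (I -> R) -> V) :
  (forall x, 0 <= N x) ->
  (forall i x y, c i (x - y) = c i x - c i y) ->
  (forall i x, `|c i x| <= N x) -> (forall x, N x <= \sum_i `|c i x|) ->
  (forall i f, c i (build f) = f i) ->
  forall u : nat -> V,
    (forall e : R, 0 < e -> \forall m & n \near \oo, N (u m - u n) < e) ->
    exists l : V, N (u n - l) @[n --> \oo] --> (0 : R).
Proof.
move=> N0 cB cN Nc cK u u_cauchy.
have u_cvg i : cvg (c i (u n) @[n --> \oo]).
  apply/cauchy_cvgP/cauchy_ballP => e e0; rewrite near_simpl/=.
  have := u_cauchy _ e0; apply: filterS => -[m n]/=.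
  by move=> umn; rewrite /ball/= -cB (le_lt_trans (cN _ _)).
exists (build (fun i => lim (c i (u n) @[n --> \oo]))).
apply: (@squeeze_cvgr _ _ _ _ (cst 0)
   (fun n => \sum_i `|c i (u n) - lim (c i (u n) @[n --> \oo])|)).
- near=> n; rewrite /= N0/= (le_trans (Nc _))//.
  by apply: ler_sum => i _; rewrite cB cK.
- exact: cvg_cst.
rewrite [X in _ --> X](_ : 0 = \sum_(i : I) `|0 : R|)/=; last first.
  by rewrite big1// => i _; rewrite normr0.
apply: cvg_big => [|i _]; [exact: add_continuous|apply: cvg_norm].
rewrite -(subrr (lim (c i (u n) @[n --> \oo]))).
by apply: cvgB; [exact: u_cvg|exact: cvg_cst].
Unshelve. all: by end_near. Qed.

Section ComplexCStar.
Variable R : realType.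

Lemma normc_Re_le (x : R[i]) : `|complex.Re x| <= Normc.normc x.
Proof. by rewrite -lecR; exact: normc_ge_Re. Qed.

Lemma normc_Im_le (x : R[i]) : `|complex.Im x| <= Normc.normc x.
Proof.
(* The imaginary part of x is minus the real part of i x. *)
have := normc_Re_le ('i * x); rewrite Normc.normcM.
case: x => a b /=; rewrite !expr0n !expr1n/= add0r sqrtr1 mul1r.
by rewrite mul0r sub0r mul1r normrN.
Qed.

Lemma normc_le_ReIm (x : R[i]) :
  Normc.normc x <= `|complex.Re x| + `|complex.Im x|.
Proof.
case: x => x y /=; rewrite -[leRHS]ger0_norm ?addr_ge0// -sqrtr_sqr.
rewrite ler_wsqrtr// sqrrD !real_normK ?num_real// lerD2r lerDl.
by rewrite mulrn_wge0// mulr_ge0.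
Qed.

Let cnorm0_eq0 (x : R[i]) : Normc.normc x = 0 -> x = 0.
Proof. exact: Normc.eq0_normc. Qed.
Let cnorm_star (x : R[i]) : Normc.normc (star x * x) = Normc.normc x ^+ 2.
Proof.
rewrite Normc.normcM expr2; congr (_ * _).
by case: x => x y /=; rewrite sqrrN.
Qed.
Let cnormZ (k x : R[i]) : Normc.normc (k *: x) = Normc.normc k * Normc.normc x.
Proof. exact: Normc.normcM. Qed.
Let cnormM (x y : R[i]) : Normc.normc (x * y) <= Normc.normc x * Normc.normc y.
Proof. by rewrite Normc.normcM. Qed.
Let cnorm_complete (u : nat -> R[i]) :
    (forall e : R, 0 < e ->
      \forall m & n \near \oo, Normc.normc (u m - u n) < e) ->
    exists l : R[i], Normc.normc (u n - l) @[n --> \oo] --> (0 : R).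
Proof.
apply: (@complete_from_coordinates R R[i] _ bool
  (fun b x => if b then complex.Re x else complex.Im x)
  (fun f => Complex (f true) (f false))).
- exact: normc_ge0.
- by move=> b [x1 x2] [y1 y2]; case: b.
- by case; [exact: normc_Re_le|exact: normc_Im_le].
- by move=> x; rewrite big_bool; exact: normc_le_ReIm.
- by case.
Qed.

HB.instance Definition _ := StarAlgebra_isCStarAlgebra.Build R R[i]
  cnorm0_eq0 (@le_normcD R) cnormZ cnormM cnorm_star cnorm_complete.

End ComplexCStar.

Section MatrixCStar.
Variables (R : realType) (n : nat).

Let cnorm_complete (u : nat -> 'M[R[i]]_n.+1) :
    (forall e : R, 0 < e -> \forall m & n \near \oo, opnorm (u m - u n) < e) ->
    exists l : 'M[R[i]]_n.+1, opnorm (u n - l) @[n --> \oo] --> (0 : R).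
Proof.
pose c (i : ('I_n.+1 * 'I_n.+1) * bool) (M : 'M[R[i]]_n.+1) :=
  if i.2 then complex.Re (M i.1.1 i.1.2) else complex.Im (M i.1.1 i.1.2).
apply: (@complete_from_coordinates R _ (@opnorm R n.+1) _ c
  (fun f => \matrix_(i, j) Complex (f ((i, j), true)) (f ((i, j), false)))).
- exact: opnorm_ge0.
- move=> [[i j] b] M N; rewrite /c !mxE/=.
  by case: (M i j) (N i j) b => [? ?] [? ?] [].
- move=> [[i j] b] M; rewrite (le_trans _ (opnorm_coord M i j))// /c/=.
  by case: b; [exact: normc_Re_le|exact: normc_Im_le].
- move=> M; rewrite (le_trans (opnorm_entries M))// pair_bigA/=.
  rewrite -(pair_bigA _ (fun ij b => `|c (ij, b) M|))/=.
  by apply: ler_sum => -[i j] _; rewrite big_bool; exact: normc_le_ReIm.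
- by move=> [[i j] []] f; rewrite /c !mxE.
Qed.

Let cnorm_star (M : 'M[R[i]]_n.+1) : opnorm (star M * M) = opnorm M ^+ 2.
Proof. exact: opnorm_cstar. Qed.

HB.instance Definition _ := StarAlgebra_isCStarAlgebra.Build R 'M[R[i]]_n.+1
  (@opnorm_eq0 R n.+1) (@opnormD R n.+1) (@opnormZ R n.+1) (@opnormM R n.+1)
  cnorm_star cnorm_complete.

End MatrixCStar.

Section CnormTheory.
Variables (R : realType) (A : cstarAlgType R).
Implicit Types x y : A.

(** From |0| <= |x| + |- x| = 2 |x|. *)
Lemma cnorm_ge0 x : 0 <= cnorm x.
Proof.
have [//|x0] := leP 0 (cnorm x).
have := cnormD x (- x); have := cnormZ (-1) x; rewrite scaleN1r => ->.
rewrite normcN Normc.normc1 mul1r subrr -[X in cnorm X](scale0r x) cnormZ.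
by rewrite Normc.normc0 mul0r; lra.
Qed.

End CnormTheory.

Section PairCStar.
Variables (R : realType) (A1 A2 : cstarAlgType R).
Implicit Types x y : (A1 * A2)%type.

Definition pair_cnorm x : R := Num.max (cnorm x.1) (cnorm x.2).

Let cnorm0_eq0 x : pair_cnorm x = 0 -> x = 0.
Proof.
case: x => x1 x2; rewrite /pair_cnorm/= => x0.
by congr (_, _); apply: cnorm0_eq0; apply/eqP;
  rewrite eq_le cnorm_ge0 -x0 le_max lexx ?orbT.
Qed.
Let cnormD x y : pair_cnorm (x + y) <= pair_cnorm x + pair_cnorm y.
Proof.
rewrite /pair_cnorm ge_max; apply/andP; split;
by rewrite (le_trans (cnormD _ _))// lerD// le_max lexx ?orbT.
Qed.
Let cnormZ (k : R[i]) x : pair_cnorm (k *: x) = Normc.normc k * pair_cnorm x.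
Proof. by rewrite /pair_cnorm maxr_pMr ?normc_ge0//= !cnormZ. Qed.
Let cnormM x y : pair_cnorm (x * y) <= pair_cnorm x * pair_cnorm y.
Proof.
rewrite /pair_cnorm ge_max; apply/andP; split;
by rewrite (le_trans (cnormM _ _))// ler_pM ?cnorm_ge0// le_max lexx ?orbT.
Qed.
Let cnorm_star x : pair_cnorm (star x * x) = pair_cnorm x ^+ 2.
Proof.
rewrite /pair_cnorm/= !cnorm_star !maxEle ler_sqr ?nnegrE ?cnorm_ge0//.
by case: ifP.
Qed.
Let cnorm_complete (u : nat -> (A1 * A2)%type) :
    (forall e : R, 0 < e -> \forall m & n \near \oo, pair_cnorm (u m - u n) < e) ->
    exists l : (A1 * A2)%type, pair_cnorm (u n - l) @[n --> \oo] --> (0 : R).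
Proof.
move=> u_cauchy.
have [e e0|l1 ul1] := @cnorm_complete R A1 (fun n => (u n).1).
  apply: filterS (u_cauchy _ e0) => -[m n]/=; apply: le_lt_trans.
  by rewrite le_max lexx.
have [e e0|l2 ul2] := @cnorm_complete R A2 (fun n => (u n).2).
  apply: filterS (u_cauchy _ e0) => -[m n]/=; apply: le_lt_trans.
  by rewrite le_max lexx orbT.
exists (l1, l2); apply: (@squeeze_cvgr _ _ _ _ (cst 0)
   (fun n => cnorm ((u n).1 - l1) + cnorm ((u n).2 - l2))).
- near=> n; rewrite /pair_cnorm/= le_max cnorm_ge0/= ge_max.
  by rewrite lerDl lerDr !cnorm_ge0.
- exact: cvg_cst.
- by rewrite -[X in _ --> X](addr0 0); exact: cvgD.
Unshelve. all: by end_near. Qed.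

HB.instance Definition _ := StarAlgebra_isCStarAlgebra.Build R (A1 * A2)%type
  cnorm0_eq0 cnormD cnormZ cnormM cnorm_star cnorm_complete.

End PairCStar.

HB.instance Definition _ (R : realType) := CStarAlgebra.on (C8_M2 R).

(** * Homomorphisms out of C, M_2 and direct sums *)

Section StarTheory.
Variables (R : realType) (V : starAlgType R).
Implicit Types x y : V.

Lemma star0 : star (0 : V) = 0.
Proof. by rewrite -(scale0r (0 : V)) starZ rmorph0 !scale0r. Qed.

Lemma starN x : star (- x) = - star x.
Proof. by rewrite -scaleN1r starZ rmorphN rmorph1 scaleN1r. Qed.

Lemma starB x y : star (x - y) = star x - star y.
Proof. by rewrite starD starN. Qed.

Lemma star1 : star (1 : V) = 1.
Proof. by have := starM (star (1 : V)) 1; rewrite mulr1 starK mulr1. Qed.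

Lemma starZ_real (k : R) x : star (k%:C *: x) = k%:C *: star x.
Proof. by rewrite starZ; congr (_ *: _); exact: conjc_real. Qed.

End StarTheory.

Section StarHom.
Variable R : realType.

(** Units need not be preserved: the summands of a direct sum are mapped to
    corners. *)
Definition star_hom (A V : starAlgType R) (phi : A -> V) : Prop :=
  [/\ linear phi, {morph phi : x y / x * y} & {morph phi : x / star x}].

Lemma star_homE (A V : starAlgType R) (phi : A -> V) : star_hom phi -> phi 1 = 1 ->
  exists2 f : {lrmorphism A -> V}, star_morphism f & f =1 phi.
Proof.
move=> [phiL phiM phiS] phi1.
pose f : {lrmorphism A -> V} := HB.pack phi
  (GRing.isLinear.Build _ _ _ _ phi phiL)
  (GRing.isMonoidMorphism.Build _ _ phi (conj phi1 phiM)).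
by exists f.
Qed.

Definition hom_pair (A1 A2 V : starAlgType R) (phi1 : A1 -> V) (phi2 : A2 -> V)
  (x : A1 * A2) : V := phi1 x.1 + phi2 x.2.

(** Orthogonality of the images of the units is enough, because
    phi1 x phi2 y = phi1 x (phi1 1 phi2 1) phi2 y. *)
Lemma star_hom_pair (A1 A2 V : starAlgType R) (phi1 : A1 -> V) (phi2 : A2 -> V) :
  star_hom phi1 -> star_hom phi2 -> phi1 1 * phi2 1 = 0 ->
  star_hom (hom_pair phi1 phi2).
Proof.
move=> [L1 M1 S1] [L2 M2 S2] o12.
have o21 : phi2 1 * phi1 1 = 0.
  by rewrite -(star1 A1) -(star1 A2) S1 S2 -starM o12 star0.
have O12 x y : phi1 x * phi2 y = 0.
  by rewrite -[x]mulr1 -[y]mul1r M1 M2 mulrA -[_ * phi1 1 * _]mulrA o12 mulr0 mul0r.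
have O21 x y : phi2 y * phi1 x = 0.
  by rewrite -[y]mulr1 -[x]mul1r M1 M2 mulrA -[_ * phi2 1 * _]mulrA o21 mulr0 mul0r.
split=> [k x y|x y|x]; rewrite /hom_pair/=.
- by rewrite L1 L2 scalerDr addrACA.
- by rewrite M1 M2 mulrDl !mulrDr O12 O21 add0r addr0.
- by rewrite S1 S2 starD.
Qed.

Definition hom_scale (V : starAlgType R) (p : V) (c : R[i]) : V := c *: p.

Lemma star_hom_scale (V : starAlgType R) (p : V) :
  projection p -> star_hom (hom_scale p).
Proof.
move=> [pS pp]; split=> [k c d|c d|c]; rewrite /hom_scale.
- by rewrite scalerDl scalerA.
- by rewrite -scalerAl -scalerAr scalerA -expr2 -pp -pS.
- by rewrite starZ -pS.
Qed.

(** The homomorphism that sends the matrix unit e_12 to v. *)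
Definition hom_mx2 (V : starAlgType R) (v : V) (M : 'M[R[i]]_2) : V :=
  M 0 0 *: (v * star v) + M 0 1 *: v + M 1 0 *: star v + M 1 1 *: (star v * v).

(** A partial isometry v of square zero yields 2 x 2 matrix units v v*, v, v*,
    v* v: the hypotheses and their adjoints are the whole multiplication table. *)
Lemma star_hom_mx2 (V : starAlgType R) (v : V) :
  v * v = 0 -> v * star v * v = v -> star_hom (hom_mx2 v).
Proof.
move=> vv vsv.
have ss : star v * star v = 0 by rewrite -starM vv star0.
have svs : star v * v * star v = star v.
  by rewrite -[in RHS]vsv !starM starK mulrA.
split=> [k M N|M N|M]; rewrite /hom_mx2.
- by rewrite !mxE !scalerDl -!scalerA !scalerDr; ncring.
- rewrite !mxE !big_ord_recl !big_ord0 !addr0.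
  rewrite (_ : lift ord0 ord0 = 1 :> 'I_2); last exact: val_inj.
  rewrite (_ : ord0 = 0 :> 'I_2); last exact: val_inj.
  rewrite !mulrDl !mulrDr -!scalerAl -!scalerAr !scalerA.
  rewrite !mulrA vv ss vsv svs ?mul0r.
  rewrite -[v * star v * star v]mulrA -[star v * v * v]mulrA ss vv.
  rewrite ?vsv ?svs !mulr0 ?mul0r !scaler0 !addr0 !add0r !scalerDl.
  by ncring.
- rewrite !mxE !starD !starZ !starM !starK; ncring.
Qed.

End StarHom.

(** * The map given by words in the generators *)

Section WordMap.
Variables (R : realType) (s : R).

Section Words.
Variable V : starAlgType R.
Variables A B C : V.

(** The matrix unit e_12 of the summand M_2, as a word in the generators; s stands
    for sqrt(t(1 - t)), the entry of B at this place. *)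
Definition off_diagonal : V := s%:C^-1 *: (A * B * (1 - A)).

Definition block_unit : V :=
  off_diagonal * star off_diagonal + star off_diagonal * off_diagonal.

Definition literal (x : bool) (X : V) : V := if x then X else 1 - X.

Definition atom (x y z : bool) : V :=
  literal x A * literal y B * literal z C * (1 - block_unit).

(** The order of the eight products follows the coordinates of the standard
    generators. *)
Definition word_map : C8_M2 R -> V :=
  hom_pair (hom_pair (hom_pair (hom_pair (hom_pair (hom_pair (hom_pair (hom_pair
    (hom_scale (atom true true true)) (hom_scale (atom true true false)))
    (hom_scale (atom true false true))) (hom_scale (atom true false false)))
    (hom_scale (atom false true true))) (hom_scale (atom false true false)))
    (hom_scale (atom false false true))) (hom_scale (atom false false false)))
    (hom_mx2 off_diagonal).

End Words.

Lemma word_map_natural (V W : starAlgType R) (g : {lrmorphism V -> W}) (A B C : V) x :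
  star_morphism g -> g (word_map A B C x) = word_map (g A) (g B) (g C) x.
Proof.
move=> gS.
have gv : g (off_diagonal A B) = off_diagonal (g A) (g B).
  by rewrite /off_diagonal linearZ/= !rmorphM rmorphB rmorph1.
have gE : g (block_unit A B) = block_unit (g A) (g B).
  by rewrite /block_unit rmorphD !rmorphM/= gS gv.
have gl y X : g (literal y X) = literal y (g X).
  by case: y => //=; rewrite rmorphB rmorph1.
have gp x1 x2 x3 : g (atom A B C x1 x2 x3) = atom (g A) (g B) (g C) x1 x2 x3.
  by rewrite /atom !rmorphM/= rmorphB/= rmorph1 !gl gE.
rewrite /word_map /hom_pair /hom_scale /hom_mx2.
move: (off_diagonal A B) (off_diagonal (g A) (g B)) gv => v w gv.
by rewrite !raddfD/= !linearZ/= !gp !rmorphM/= !gS !gv.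
Qed.

Lemma word_map_closed (V : cstarAlgType R) (A B C : V) (S : set V) x :
  closed_star_subalgebra S -> S A -> S B -> S C -> S (word_map A B C x).
Proof.
move=> [_ S1 SL SM SS] SA SB SC.
have S0 : S 0 by rewrite -(addNr 1) -scaleN1r; exact: SL.
have SD u v : S u -> S v -> S (u + v) by move=> ? ?; rewrite -[u]scale1r; exact: SL.
have SZ k u : S u -> S (k *: u) by move=> ?; rewrite -[k *: u]addr0; exact: SL.
have SB1 u : S u -> S (1 - u).
  by move=> ?; apply: (SD) => //; rewrite -scaleN1r; exact: SZ.
have Sv : S (off_diagonal A B) by apply: (SZ); apply: (SM); [exact: SM|exact: SB1].
have SE : S (block_unit A B) by apply: (SD); apply: (SM) => //; exact: SS.
have Sl y X : S X -> S (literal y X) by case: y => //=; exact: SB1.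
have Sp x1 x2 x3 : S (atom A B C x1 x2 x3).
  apply: (SM); last exact: SB1.
  by apply: (SM); [apply: (SM)|]; exact: Sl.
rewrite /word_map /hom_pair /hom_scale /hom_mx2.
do !apply: (SD); apply: (SZ) => //; [exact: (SM _ _ Sv (SS _ Sv))|exact: SS|].
exact: (SM _ _ (SS _ Sv) Sv).
Qed.

End WordMap.

Section WordHom.
Variables (R : realType) (s : R) (V : starAlgType R) (A B C : V).

(* E is central, the generators commute below 1 - E, and v is a partial
   isometry. *)
Let v := off_diagonal s A B.
Let E := block_unit s A B.
Hypotheses (pA : projection A) (pB : projection B) (pC : projection C).
Hypotheses (EA : E * A = A * E) (EB : E * B = B * E) (EC : E * C = C * E).
Hypotheses (AB : A * B * (1 - E) = B * A * (1 - E))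
  (AC : A * C * (1 - E) = C * A * (1 - E)) (BC : B * C * (1 - E) = C * B * (1 - E)).
Hypothesis vsv : v * star v * v = v.

Let AA : A * A = A. Proof. by case: pA => As AA; rewrite -expr2 -AA -As. Qed.

Lemma off_diagonal_sqr0 : v * v = 0.
Proof.
rewrite /v /off_diagonal -scalerAl -scalerAr !mulrA -[_ * (1 - A) * A]mulrA.
by rewrite mulrBl mul1r AA subrr mulr0 !mul0r !scaler0.
Qed.

Let F := 1 - E.

Lemma block_unit_idem : E * E = E.
Proof.
have ss : star v * star v = 0 by rewrite -starM off_diagonal_sqr0 star0.
have svs : star v * v * star v = star v.
  by rewrite -[in RHS]vsv !starM starK mulrA.
rewrite /E /block_unit -/v mulrDl !mulrDr !mulrA vsv svs.
rewrite -[v * star v * star v]mulrA -[star v * v * v]mulrA ss off_diagonal_sqr0.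
by rewrite !mulr0 !mul0r addr0 add0r.
Qed.

Let FF : F * F = F.
Proof. by rewrite /F mulrBl mul1r mulrBr mulr1 block_unit_idem subrr subr0. Qed.

Let EF : F * E = 0.
Proof. by rewrite /F mulrBl mul1r block_unit_idem subrr. Qed.

Let starF : star F = F.
Proof. by rewrite /F starB star1 /E /block_unit starD !starM !starK. Qed.

Let commF (X : V) : E * X = X * E -> X * F = F * X.
Proof. by move=> EX; rewrite /F mulrBr mulrBl EX mulr1 mul1r. Qed.

Let litF x X : E * X = X * E -> literal x X * F = F * literal x X.
Proof.
move=> EX; case: x => /=; first exact: commF.
by rewrite [LHS]mulrBl [RHS]mulrBr mul1r mulr1 commF.
Qed.

Let lit_comm x y (X Y G : V) : X * Y * G = Y * X * G ->
  literal x X * literal y Y * G = literal y Y * literal x X * G.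
Proof.
move=> XY; case: x; case: y => //=;
  rewrite ?(mulrBl, mulrBr, mul1r, mulr1) ?XY; ncring.
Qed.

Let lit_idem x (X : V) : projection X -> literal x X * literal x X = literal x X.
Proof.
move=> [Xs XX]; have {Xs}XX : X * X = X by rewrite -expr2 -XX -Xs.
case: x => //=; rewrite mulrBl mul1r mulrBr mulr1 XX subrr subr0 //.
Qed.

Let lit_orth x y (X : V) : projection X -> x != y -> literal x X * literal y X = 0.
Proof.
move=> [Xs XX]; have {Xs}XX : X * X = X by rewrite -expr2 -XX -Xs.
by case: x; case: y => //= _; rewrite ?mulrBl ?mulrBr ?mul1r ?mulr1 XX subrr.
Qed.

Let lit_star x (X : V) : projection X -> star (literal x X) = literal x X.
Proof. by case=> Xs _; case: x; rewrite /= ?starB ?star1 -Xs. Qed.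

(* Once multiplied by F, the literals commute with each other, so that products
   of atoms can be reordered letter by letter. *)
Let L x (X : V) := literal x X * F.

Let cut_mul (x y G : V) : G * G = G -> y * G = G * y ->
  (x * G) * (y * G) = x * y * G.
Proof.
by move=> GG yG; rewrite -mulrA [G * (y * G)]mulrA -yG -[y * G * G]mulrA GG mulrA.
Qed.

Let LM x y (X Y : V) : E * Y = Y * E ->
  L x X * L y Y = literal x X * literal y Y * F.
Proof. by move=> EY; rewrite /L cut_mul// litF. Qed.

Let LC x y (X Y : V) : E * X = X * E -> E * Y = Y * E -> X * Y * F = Y * X * F ->
  L x X * L y Y = L y Y * L x X.
Proof. by move=> EX EY XY; rewrite !LM// (lit_comm x y XY). Qed.

Let LS x (X : V) : projection X -> E * X = X * E -> star (L x X) = L x X.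
Proof. by move=> pX EX; rewrite /L starM starF lit_star// litF. Qed.

Let atomE x y z : atom s A B C x y z = L x A * L y B * L z C.
Proof. by rewrite LM// /L cut_mul// litF. Qed.

Let comm_mul3 (a b c a' b' c' : V) :
  c * a' = a' * c -> b * a' = a' * b -> c * b' = b' * c ->
  a * b * c * (a' * b' * c') = (a * a') * (b * b') * (c * c').
Proof.
move=> ca ba cb; rewrite !mulrA -[_ * c * a']mulrA ca mulrA.
by rewrite -[_ * b * a']mulrA ba mulrA -[_ * c * b']mulrA cb mulrA.
Qed.

Let atomM x y z x' y' z' :
  atom s A B C x y z * atom s A B C x' y' z' =
  (L x A * L x' A) * (L y B * L y' B) * (L z C * L z' C).
Proof. by rewrite !atomE comm_mul3 //; apply: LC. Qed.

Let comm_rev3 (a b c : V) : b * a = a * b -> c * a = a * c -> c * b = b * c ->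
  c * (b * a) = a * b * c.
Proof. by move=> ba ca cb; rewrite ba mulrA ca -mulrA cb mulrA. Qed.

Let L_idem x (X : V) : projection X -> E * X = X * E -> L x X * L x X = L x X.
Proof. by move=> pX EX; rewrite LM// lit_idem. Qed.

Let L_orth x y (X : V) : projection X -> E * X = X * E -> x != y ->
  L x X * L y X = 0.
Proof. by move=> pX EX xy; rewrite LM// lit_orth// mul0r. Qed.

Lemma atom_projection x y z : projection (atom s A B C x y z).
Proof.
have selfadj : star (atom s A B C x y z) = atom s A B C x y z.
  rewrite atomE (starM (L x A * L y B)) (starM (L x A)) !LS//.
  by rewrite comm_rev3 //; apply: LC.
split; first exact: esym.
by rewrite selfadj expr2 atomM !L_idem// -atomE.
Qed.

Lemma atom_orth x y z x' y' z' : (x, y, z) != (x', y', z') ->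
  atom s A B C x y z * atom s A B C x' y' z' = 0.
Proof.
rewrite atomM !xpair_eqE !negb_and => /orP[/orP[]|] h.
- by rewrite (L_orth pA EA h) !mul0r.
- by rewrite (L_orth pB EB h) mulr0 mul0r.
- by rewrite (L_orth pC EC h) mulr0.
Qed.

Lemma atom_block x y z : atom s A B C x y z * E = 0.
Proof. by rewrite /atom -/E -mulrA EF mulr0. Qed.

Lemma word_map_star_hom : star_hom (word_map s A B C).
Proof.
have hp x y z := star_hom_scale (atom_projection x y z).
rewrite /word_map.
refine (star_hom_pair (star_hom_pair (star_hom_pair (star_hom_pair
  (star_hom_pair (star_hom_pair (star_hom_pair (star_hom_pair (hp _ _ _) (hp _ _
  _) _) (hp _ _ _) _) (hp _ _ _) _) (hp _ _ _) _) (hp _ _ _) _) (hp _ _ _) _)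
  (hp _ _ _) _) (star_hom_mx2 off_diagonal_sqr0 vsv) _).
all: rewrite /hom_pair /hom_scale /hom_mx2 /= ?scale1r ?mulrDl ?atom_orth ?addr0//.
rewrite !mxE/= !scale1r !scale0r !addr0 -/(block_unit s A B) -/E.
by rewrite !atom_block !addr0.
Qed.

Lemma word_map1 : word_map s A B C 1 = 1.
Proof.
rewrite /word_map /hom_pair /hom_scale /hom_mx2 /= !scale1r.
rewrite !mxE/= !scale1r !scale0r !addr0.
rewrite -[X in _ + X = _]/E.
rewrite /atom -/E -/F /=.
transitivity (F + E); last by rewrite subrK.
ncring.
Qed.

End WordHom.

(** The atoms that make up A add up to A (1 - E), and likewise for B and C. *)
Section WordValues.
Variables (R : realType) (s : R) (V : starAlgType R) (A B C : V).

Let word_mapE (x1 x2 x3 x4 x5 x6 x7 x8 : R[i]) M :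
  word_map s A B C (x1, x2, x3, x4, x5, x6, x7, x8, M) =
    x1 *: atom s A B C true true true + x2 *: atom s A B C true true false
  + x3 *: atom s A B C true false true + x4 *: atom s A B C true false false
  + x5 *: atom s A B C false true true + x6 *: atom s A B C false true false
  + x7 *: atom s A B C false false true + x8 *: atom s A B C false false false
  + hom_mx2 (off_diagonal s A B) M.
Proof. by []. Qed.

Lemma word_map_A (M : 'M[R[i]]_2) :
  word_map s A B C (1, 1, 1, 1, 0, 0, 0, 0, M) =
  A * (1 - block_unit s A B) + hom_mx2 (off_diagonal s A B) M.
Proof.
rewrite word_mapE !scale0r !scale1r !addr0 /atom /=; congr (_ + _).
by move: (1 - block_unit s A B) => F; ncring.
Qed.

Lemma word_map_B (M : 'M[R[i]]_2) :
  word_map s A B C (1, 1, 0, 0, 1, 1, 0, 0, M) =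
  B * (1 - block_unit s A B) + hom_mx2 (off_diagonal s A B) M.
Proof.
rewrite word_mapE !scale0r !scale1r !addr0 /atom /=; congr (_ + _).
by move: (1 - block_unit s A B) => F; ncring.
Qed.

Lemma word_map_C (M : 'M[R[i]]_2) :
  word_map s A B C (1, 0, 1, 0, 1, 0, 1, 0, M) =
  C * (1 - block_unit s A B) + hom_mx2 (off_diagonal s A B) M.
Proof.
rewrite word_mapE !scale0r !scale1r !addr0 /atom /=; congr (_ + _).
by move: (1 - block_unit s A B) => F; ncring.
Qed.

End WordValues.

(** * The structure forced by the relations *)

Definition tparam (R : realType) (a b : R) : R :=
  (b ^+ 2 + 2 * a ^+ 2 * b - a ^+ 2 * b ^+ 2 - a ^+ 2) / (4 * a ^+ 2 * b).

(** Twice this number minus one is half the anticommutator of 2C - 1 and 2A - 1 on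
    the commutator of A and B. *)
Definition zparam (R : realType) (a b : R) : R :=
  1 / 2 + (a / b ^+ 2 - a^-1 - a) / 4.

Definition sparam (R : realType) (a b : R) : R :=
  Num.sqrt (tparam a b * (1 - tparam a b)).

Section Relations.
Variables (R : realType) (a b : R) (V : starAlgType R) (A B C : V).
Hypotheses (a0 : a != 0) (b0 : b != 0) (rel : projection_relations a b A B C).
Hypothesis t01 : 0 < tparam a b < 1.

Let t := tparam a b.
Let z := zparam a b.
Let s := sparam a b.
Let be := a / b.
Let D := A * B - B * A.

Let ac0 : a%:C != 0. Proof. by rewrite fmorph_eq0. Qed.
Let bc0 : b%:C != 0. Proof. by rewrite fmorph_eq0. Qed.
Let bec0 : be%:C != 0. Proof. by rewrite fmorph_eq0 mulf_neq0// invr_eq0. Qed.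
Let K2 : 2 != 0 :> R[i]. Proof. by rewrite pnatr_eq0. Qed.

Let ss : s%:C * s%:C = (t * (1 - t))%:C.
Proof.
rewrite -rmorphM/= -expr2 sqr_sqrtr// mulr_ge0// ?subr_ge0.
all: by case/andP: t01 => /ltW ? /ltW ?.
Qed.

Let s0 : s%:C != 0.
Proof.
by rewrite fmorph_eq0 gt_eqF// sqrtr_gt0 mulr_gt0// ?subr_gt0; case/andP: t01.
Qed.

Let idem (X : V) : projection X -> X * X = X.
Proof. by move=> [Xs XX]; rewrite -expr2 -XX -Xs. Qed.

Let pA : projection A. Proof. by case: rel. Qed.
Let pB : projection B. Proof. by case: rel. Qed.
Let pC : projection C. Proof. by case: rel. Qed.
Let AA : A * A = A. Proof. exact: idem. Qed.
Let BB : B * B = B. Proof. exact: idem. Qed.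
Let CC : C * C = C. Proof. exact: idem. Qed.

Let dCA : C * A - A * C = be%:C *: D.
Proof.
case: rel => _ _ _ + _; rewrite /commutator mulrDr mulrDl -!scalerAr -!scalerAl.
move=> h; apply: (scalerI bc0); rewrite scalerA -rmorphM/= /be mulrC divfK//.
apply/esym/eqP; rewrite -subr_eq0 /D !scalerBr -[X in _ == X]h; apply/eqP; ncring.
Qed.

Let dBC : B * C - C * B = a%:C *: D.
Proof.
case: rel => _ _ _ _; rewrite /commutator mulrDr mulrDl -!scalerAr -!scalerAl.
move=> h; apply/eqP; rewrite -subr_eq0 /D !scalerBr -[X in _ == X]h.
by apply/eqP; ncring.
Qed.

Let Dm : D * (A * B + B * A - A - B) = (t - 1)%:C *: D.
Proof.
rewrite (commutator_moment_AB K2 ac0 bec0 AA BB CC erefl dBC dCA).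
congr (_ *: _); rewrite /be /t /tparam; field.
by rewrite ac0 bc0 ?pnatr_eq0.
Qed.

Let Dn : D * (C * A + A * C - C - A) = (z - 1)%:C *: D.
Proof.
rewrite (commutator_moment_CA K2 ac0 bec0 AA BB CC erefl dBC dCA).
congr (_ *: _); rewrite /be /z /zparam; field.
by rewrite ac0 bc0 ?pnatr_eq0.
Qed.

Let D3 : D * D * D = - (s%:C * s%:C) *: D.
Proof.
rewrite (idempotent_commutator_cube K2 ac0 bec0 AA BB CC erefl dBC dCA) ss.
congr (_ *: _); rewrite /be /t /tparam; field.
by rewrite ac0 bc0 ?pnatr_eq0.
Qed.

Let AD : A * D + D * A = D. Proof. exact: (commutator_anticommA AA erefl). Qed.
Let BD : B * D + D * B = D. Proof. exact: (commutator_anticommB BB erefl). Qed.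
Let CD : C * D + D * C = D. Proof. exact: (commutator_anticommC bec0 CC dCA). Qed.

Let Ds : star D = - D.
Proof.
case: pA pB => As _ [Bs _]; by rewrite /D starB !starM -As -Bs opprB.
Qed.

Let v := off_diagonal s A B.
Let E := block_unit s A B.

Let vE : v = s%:C^-1 *: (A * D).
Proof.
rewrite /v /off_diagonal /D; congr (_ *: _).
by transitivity (A * A * B - A * B * A); [rewrite AA|]; ncring.
Qed.

Let vsE : star v = - (s%:C^-1 *: (D * A)).
Proof.
rewrite vE -fmorphV starZ_real starM Ds; case: pA => <- _.
by rewrite mulNr scalerN.
Qed.

Let vvsE : v * star v = - (s%:C^-1 * s%:C^-1) *: (A * (D * D)).
Proof.
rewrite vsE vE mulrN -scalerAl -scalerAr scalerA scaleNr; congr (- (_ *: _)).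
by rewrite -mulrA [D * (D * A)]mulrA -(anticomm_sqr_comm AD) [LHS]mulrA AA.
Qed.

(* v v* and v* v are - A D^2 / s^2 and - (1 - A) D^2 / s^2. *)
Let EE : E = - (s%:C^-1 * s%:C^-1) *: (D * D).
Proof.
rewrite /E /block_unit -/v vvsE vsE vE mulNr -scalerAl -scalerAr scalerA -scaleNr.
rewrite -scalerDr; congr (_ *: _).
transitivity ((A * D + D * (A * A)) * D); last by rewrite AA AD.
by clearbody D; ncring.
Qed.

Let DE : D * E = D.
Proof.
rewrite EE -scalerAr mulrA D3 scalerA mulrNN.
by rewrite mulrACA mulVf// mulr1 scale1r.
Qed.

Let ED : E * D = D.
Proof.
rewrite EE -scalerAl D3 scalerA mulrNN.
by rewrite mulrACA mulVf// mulr1 scale1r.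
Qed.

Let commE (X : V) : X * D + D * X = D -> E * X = X * E.
Proof. by move=> XD; rewrite EE -scalerAl -scalerAr anticomm_sqr_comm. Qed.

Let vvs : v * star v = A * E.
Proof. by rewrite vvsE EE scalerAr. Qed.

Let vsv : star v * v = E - A * E.
Proof. by rewrite -vvs /E /block_unit -/v addrAC subrr add0r. Qed.

Let vvsv : v * star v * v = v.
Proof.
rewrite vvs vE -scalerAr mulrA -[A * E * A]mulrA commE//.
by rewrite mulrA AA -mulrA ED.
Qed.

Let offE (X Y : V) (k : R[i]) : X * Y - Y * X = k *: D ->
  X * Y * (1 - E) = Y * X * (1 - E).
Proof.
move=> h; apply/eqP; rewrite -subr_eq0 -mulrBl h -scalerAl.
by rewrite mulrBr mulr1 DE subrr scaler0.
Qed.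

Let AB1 : A * B * (1 - E) = B * A * (1 - E).
Proof. by apply: (@offE _ _ 1); rewrite scale1r. Qed.
Let AC1 : A * C * (1 - E) = C * A * (1 - E).
Proof. exact/esym/(offE dCA). Qed.
Let BC1 : B * C * (1 - E) = C * B * (1 - E).
Proof. exact: (offE dBC). Qed.

Let EA := commE AD.
Let EB := commE BD.
Let EC := commE CD.

Lemma word_hom : exists2 f : {lrmorphism C8_M2 R -> V},
  star_morphism f & f =1 word_map s A B C.
Proof.
apply: star_homE; first exact: word_map_star_hom.
exact: word_map1.
Qed.

Let E_star : star E = E.
Proof. by rewrite /E /block_unit starD !starM !starK. Qed.

(* Self-adjointness of m and E turns E m = k E into m E = k E. *)
Let momentE (m : V) (k : R) : star m = m -> D * m = k%:C *: D -> m * E = k%:C *: E.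
Proof.
move=> ms Dm'; rewrite -{1}ms -{1}E_star -starM.
rewrite {1}EE -scalerAl -mulrA Dm' -scalerAr scalerA mulrC -scalerA -EE.
by rewrite starZ_real E_star.
Qed.

Lemma word_map_gen_A : word_map s A B C (1, 1, 1, 1, 0, 0, 0, 0, rmx2 1 0 0 0) = A.
Proof.
rewrite word_map_A -/E -/v /hom_mx2 !mxE/= !scale0r scale1r !addr0 vvs.
by rewrite mulrBr mulr1 subrK.
Qed.

Lemma word_map_gen_B :
  word_map s A B C (1, 1, 0, 0, 1, 1, 0, 0, rmx2 t s s (1 - t)) = B.
Proof.
have BE : B * E = t%:C *: (A * E) + 1 *: (A * D) - 1 *: (D * A)
                   + (1 - t%:C) *: (E - A * E).
  apply: compress_idempotent => //.
    by rewrite -/D scale1r.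
  rewrite -[1](rmorph1 (real_complex R)) -rmorphB; apply: momentE => //.
  by rewrite !(starB, starD, starM); case: pA pB => <- _ [<- _]; ncring.
rewrite word_map_B -/E -/v /hom_mx2 !mxE/= vvs vsv vsE vE scalerN !scalerA mulfV//.
by rewrite rmorphB rmorph1 -BE mulrBr mulr1 subrK.
Qed.

Lemma word_map_gen_C :
  word_map s A B C (1, 0, 1, 0, 1, 0, 1, 0,
     rmx2 z (- (a / b) * s) (- (a / b) * s) (1 - z)) = C.
Proof.
have CE : C * E = z%:C *: (A * E) + (- be%:C) *: (A * D) - (- be%:C) *: (D * A)
                   + (1 - z%:C) *: (E - A * E).
  apply: compress_idempotent => //.
    by rewrite -opprB dCA mulNr -scalerAl DE scaleNr.
  rewrite -[1](rmorph1 (real_complex R)) -rmorphB; apply: momentE.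
    by rewrite !(starB, starD, starM); case: pA pC => <- _ [<- _]; ncring.
  by rewrite -Dn; congr (_ * _); ncring.
rewrite word_map_C -/E -/v /hom_mx2 !mxE/= vvs vsv vsE vE scalerN !scalerA.
rewrite -/be rmorphM/= mulfK// rmorphN.
by rewrite rmorphB rmorph1 -CE mulrBr mulr1 subrK.
Qed.

End Relations.

(** * The standard generators of C^8 + M_2 *)

Section RealMatrices.
Variable R : realType.
Implicit Types x y k : R.

Let mx2P (M N : 'M[R[i]]_2) : M 0 0 = N 0 0 -> M 0 1 = N 0 1 ->
  M 1 0 = N 1 0 -> M 1 1 = N 1 1 -> M = N.
Proof.
move=> h00 h01 h10 h11; apply/matrixP => i j.
have i01 (k : 'I_2) : k = 0 \/ k = 1.
  by case: k => -[|[|//]] h; [left|right]; exact: val_inj.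
by case: (i01 i) (i01 j) => -> [] ->.
Qed.

Lemma rmx2_mul x1 x2 x3 x4 y1 y2 y3 y4 :
  rmx2 x1 x2 x3 x4 * rmx2 y1 y2 y3 y4 =
  rmx2 (x1 * y1 + x2 * y3) (x1 * y2 + x2 * y4)
       (x3 * y1 + x4 * y3) (x3 * y2 + x4 * y4).
Proof.
apply: mx2P; rewrite !mxE !big_ord_recl big_ord0 !mxE /= addr0.
all: by rewrite rmorphD !rmorphM.
Qed.

Lemma rmx2_add x1 x2 x3 x4 y1 y2 y3 y4 :
  rmx2 x1 x2 x3 x4 + rmx2 y1 y2 y3 y4 =
  rmx2 (x1 + y1) (x2 + y2) (x3 + y3) (x4 + y4).
Proof. by apply: mx2P; rewrite !mxE /= rmorphD. Qed.

Lemma rmx2_scale k x1 x2 x3 x4 :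
  k%:C *: rmx2 x1 x2 x3 x4 = rmx2 (k * x1) (k * x2) (k * x3) (k * x4).
Proof. by apply: mx2P; rewrite !mxE /= rmorphM. Qed.

Lemma rmx2_opp x1 x2 x3 x4 :
  - rmx2 x1 x2 x3 x4 = rmx2 (- x1) (- x2) (- x3) (- x4).
Proof. by apply: mx2P; rewrite !mxE /= rmorphN. Qed.

Lemma rmx2_star x1 x2 x3 x4 : star (rmx2 x1 x2 x3 x4) = rmx2 x1 x3 x2 x4.
Proof. by apply: mx2P; rewrite !mxE /=; exact: conjc_real. Qed.

Lemma rmx2_1 : 1 = rmx2 1 0 0 1 :> 'M[R[i]]_2.
Proof. by apply: mx2P; rewrite !mxE. Qed.

Lemma rmx2_0 : 0 = rmx2 0 0 0 0 :> 'M[R[i]]_2.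
Proof. by apply: mx2P; rewrite !mxE. Qed.

Lemma hom_mx2_id (M : 'M[R[i]]_2) : hom_mx2 (rmx2 0 1 0 0) M = M.
Proof.
rewrite /hom_mx2 rmx2_star !rmx2_mul.
apply: mx2P; rewrite !mxE /=.
all: by rewrite ?(mul0r, mulr0, add0r, addr0, mulr1, rmorph0, rmorph1).
Qed.

End RealMatrices.

Section WordMapPair.
Variables (R : realType) (s : R) (A1 A2 : starAlgType R).
Implicit Types X Y Z : (A1 * A2)%type.

Let offP X Y : off_diagonal s X Y = (off_diagonal s X.1 Y.1, off_diagonal s X.2 Y.2).
Proof. by []. Qed.

Let atomP X Y Z u v w : atom s X Y Z u v w =
  (atom s X.1 Y.1 Z.1 u v w, atom s X.2 Y.2 Z.2 u v w).
Proof. by case: u; case: v; case: w. Qed.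

(** Words are evaluated summand by summand. *)
Lemma word_map_pair X Y Z x : word_map s X Y Z x =
  (word_map s X.1 Y.1 Z.1 x, word_map s X.2 Y.2 Z.2 x).
Proof. by rewrite /word_map /hom_pair /hom_scale /hom_mx2 offP !atomP. Qed.

Lemma relations_pair (a b : R) (x1 y1 z1 : A1) (x2 y2 z2 : A2) :
  projection_relations a b x1 y1 z1 -> projection_relations a b x2 y2 z2 ->
  projection_relations a b (V := (A1 * A2)%type) (x1, x2) (y1, y2) (z1, z2).
Proof.
move=> [[xs1 xx1] [ys1 yy1] [zs1 zz1] c1 d1] [[xs2 xx2] [ys2 yy2] [zs2 zz2] c2 d2].
by split; [split|split|split|..]; apply: injective_projections.
Qed.

End WordMapPair.

Section StandardGenerators.
Variable R : realType.
Variables a b : R.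
Hypotheses (a0 : a != 0) (b0 : b != 0).
Hypothesis t01 : 0 < tparam a b < 1.
Let t := tparam a b.
Let z := zparam a b.
Let s := sparam a b.

Definition gen_A : C8_M2 R := (1, 1, 1, 1, 0, 0, 0, 0, rmx2 1 0 0 0).
Definition gen_B : C8_M2 R :=
  (1, 1, 0, 0, 1, 1, 0, 0,
   rmx2 (tparam a b) (sparam a b) (sparam a b) (1 - tparam a b)).
Definition gen_C : C8_M2 R := (1, 0, 1, 0, 1, 0, 1, 0,
  rmx2 (zparam a b) (- (a / b) * sparam a b) (- (a / b) * sparam a b)
       (1 - zparam a b)).

Let s0 : s != 0.
Proof.
by rewrite gt_eqF// sqrtr_gt0 mulr_gt0// ?subr_gt0; case/andP: t01.
Qed.

Let ss : s * s = t * (1 - t).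
Proof.
rewrite -expr2 sqr_sqrtr// mulr_ge0// ?subr_ge0.
all: by case/andP: t01 => /ltW ? /ltW ?.
Qed.

Let simpC := (mul0r, mulr0, mul1r, mulr1, add0r, addr0, subrr, subr0, oppr0).

(* On a character of the summand C^8 exactly one atom is 1, and e_12 is 0. *)
Let word_scalar (u v w : bool) (x : C8_M2 R) :
  word_map s (u%:R : R[i]) v%:R w%:R x =
  if u then if v then if w then x.1.1.1.1.1.1.1.1 else x.1.1.1.1.1.1.1.2
            else if w then x.1.1.1.1.1.1.2 else x.1.1.1.1.1.2
  else if v then if w then x.1.1.1.1.2 else x.1.1.1.2
       else if w then x.1.1.2 else x.1.2.
Proof.
have off0 : off_diagonal s (u%:R : R[i]) v%:R = 0.
  by rewrite /off_diagonal; case: u; rewrite !simpC scaler0.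
rewrite /word_map /hom_pair /hom_scale /hom_mx2 /atom /block_unit off0.
rewrite /literal star0 !simpC !scaler0 !simpC.
have scE (k y : R[i]) : k *: y = k * y by [].
by case: u {off0}; case: v; case: w; rewrite !scE !simpC.
Qed.

(* In M_2 the word for e_12 is e_12, its block unit is 1, and all atoms vanish. *)
Let word_matrix (x : C8_M2 R) C :
  word_map s (rmx2 1 0 0 0) (rmx2 t s s (1 - t)) C x = x.2.
Proof.
have offE : off_diagonal s (rmx2 1 0 0 0) (rmx2 t s s (1 - t)) = rmx2 0 1 0 0.
  rewrite /off_diagonal rmx2_1 -fmorphV !(rmx2_opp, rmx2_add, rmx2_mul, rmx2_scale).
  by rewrite !simpC mulVf.
have blockE : block_unit s (rmx2 1 0 0 0) (rmx2 t s s (1 - t)) = 1.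
  by rewrite /block_unit offE rmx2_star !rmx2_mul rmx2_add rmx2_1 !simpC.
rewrite /word_map /hom_pair /hom_scale /atom blockE offE subrr !mulr0 !scaler0.
by rewrite !add0r hom_mx2_id.
Qed.

Lemma word_map_id x : word_map s gen_A gen_B gen_C x = x.
Proof.
(* word_map_pair needs the target in sight as a product of algebras. *)
rewrite -[LHS]/(word_map s (gen_A : R[i] * R[i] * R[i] * R[i] * R[i] * R[i]
  * R[i] * R[i] * 'M[R[i]]_2) gen_B gen_C x).
rewrite !word_map_pair /= word_matrix.
rewrite -[1]/(true%:R) -[0]/(false%:R) !word_scalar.
by case: x => -[[[[[[[[x1 x2] x3] x4] x5] x6] x7] x8] M].
Qed.

(* C is a projection in M_2. *)
Let zz : z * (1 - z) = (a / b) ^+ 2 * (t * (1 - t)).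
Proof. by rewrite /z /t /zparam /tparam; field; rewrite a0 b0. Qed.

(* C + a A commutes with B in M_2. *)
Let zt : 1 - z - z = a - (a / b) * (1 - t - t).
Proof. by rewrite /z /t /zparam /tparam; field; rewrite a0 b0. Qed.

(** The radicand in w is (2z - 1)^2, by the identity that makes C a projection. *)
Lemma zparam_eq (w := Num.sqrt (1 - 4 * a ^+ 2 / b ^+ 2 * (t * (1 - t)))) :
  z = 1 / 2 + 1 / 2 * w \/ z = 1 / 2 - 1 / 2 * w.
Proof.
have -> : w = `|z + z - 1|.
  rewrite -sqrtr_sqr; congr Num.sqrt.
  transitivity (1 - 4 * ((a / b) ^+ 2 * (t * (1 - t)))); first by field.
  by rewrite -zz; ring.
by case: ger0P => _; [left|right]; field.
Qed.

Lemma C8_relations (x1 x2 x3 x4 x5 x6 x7 x8 y1 y2 y3 y4 y5 y6 y7 y8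
    z1 z2 z3 z4 z5 z6 z7 z8 : R[i]) (M N P : 'M[R[i]]_2) :
  projection_relations a b x1 y1 z1 -> projection_relations a b x2 y2 z2 ->
  projection_relations a b x3 y3 z3 -> projection_relations a b x4 y4 z4 ->
  projection_relations a b x5 y5 z5 -> projection_relations a b x6 y6 z6 ->
  projection_relations a b x7 y7 z7 -> projection_relations a b x8 y8 z8 ->
  projection_relations a b M N P ->
  projection_relations a b (V := C8_M2 R)
    (x1, x2, x3, x4, x5, x6, x7, x8, M) (y1, y2, y3, y4, y5, y6, y7, y8, N)
    (z1, z2, z3, z4, z5, z6, z7, z8, P).
Proof.
by move=> h1 h2 h3 h4 h5 h6 h7 h8 h9; do 8![apply: relations_pair => //].
Qed.

Let projection0 : projection (0 : R[i]).
Proof. by split; rewrite ?expr0n; rewrite star0. Qed.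
Let projection1 : projection (1 : R[i]).
Proof. by split; rewrite ?expr1n; rewrite star1. Qed.
Let relations_scalar (x1 x2 x3 : R[i]) :
  projection x1 -> projection x2 -> projection x3 -> projection_relations a b x1 x2 x3.
Proof. by move=> px py pz; split=> //; rewrite /commutator mulrC subrr. Qed.

Let relations_matrix : projection_relations a b (rmx2 1 0 0 0)
  (rmx2 t s s (1 - t)) (rmx2 z (- (a / b) * s) (- (a / b) * s) (1 - z)).
Proof.
have proj (x y : R) : y * y = x * (1 - x) -> projection (rmx2 x y y (1 - x)).
  move=> yy; split; rewrite rmx2_star// expr2 rmx2_mul.
  by congr rmx2; rewrite ?yy; ring.
split.
- by have := proj 1 0; rewrite subrr !simpC; exact.
- exact: proj.
- by apply: proj; rewrite zz -ss; ring.
- rewrite /commutator !(rmx2_mul, rmx2_opp, rmx2_add, rmx2_scale) rmx2_0 !simpC.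
  by congr rmx2; field.
- rewrite /commutator !(rmx2_mul, rmx2_opp, rmx2_add, rmx2_scale) rmx2_0 !simpC.
  congr rmx2; try ring.
  + transitivity (s * ((1 - z - z) - (a - a / b * (1 - t - t)))); first by ring.
    by rewrite zt subrr mulr0.
  + transitivity (- s * ((1 - z - z) - (a - a / b * (1 - t - t)))); first by ring.
    by rewrite zt subrr mulr0.
Qed.

(** In C^8 the relations are trivial; in M_2 the first one holds because B and C
    have proportional off-diagonal entries, and the second is zt. *)
Lemma generators_relations : projection_relations a b gen_A gen_B gen_C.
Proof.
apply: C8_relations; last exact: relations_matrix.
all: apply: relations_scalar; (exact: projection0 || exact: projection1).
Qed.

End StandardGenerators.

(** * Universality *)

Section Universal.
Variables (R : realType) (a b : R).
Hypotheses (a0 : a != 0) (b0 : b != 0).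
Hypothesis t01 : 0 < tparam a b < 1.
Local Notation gA := (gen_A R).
Local Notation gB := (gen_B a b).
Local Notation gC := (gen_C a b).

(** Homomorphisms commute with words, and every element of C^8 + M_2 is its own
    word in the standard generators. *)
Lemma word_hom_unique (V : starAlgType R) (A B C : V) (g : {lrmorphism C8_M2 R -> V}) :
  star_morphism g -> g gA = A -> g gB = B -> g gC = C ->
  g =1 word_map (sparam a b) A B C.
Proof.
by move=> gS <- <- <- x; rewrite -word_map_natural// word_map_id.
Qed.

Lemma word_hom_exists (V : starAlgType R) (A B C : V) :
  projection_relations a b A B C ->
  exists f : {lrmorphism C8_M2 R -> V},
    [/\ star_morphism f, f gA = A, f gB = B & f gC = C].
Proof.
move=> rel; have [f fS fE] := word_hom a0 b0 rel t01.
exists f; split=> //; rewrite fE.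
- by apply: word_map_gen_A.
- by apply: word_map_gen_B.
- by apply: word_map_gen_C.
Qed.

Lemma C8_M2_universal : universal_cstar_algebra a b gA gB gC.
Proof.
split.
- exact: generators_relations.
- move=> S Scl GS; apply/seteqP; split=> // x _.
  rewrite -(word_map_id t01 x); apply: word_map_closed => //;
    by apply: GS; rewrite /=; tauto.
- move=> V A B C rel; have [f [fS fA fB fC]] := word_hom_exists rel.
  exists f; split=> // g [gS gA' gB' gC'] x.
  by rewrite (word_hom_unique gS gA' gB' gC') (word_hom_unique fS fA fB fC).
Qed.

(** The map from U given by its universal property and the map back given by
    words compose to the identity: on U by uniqueness, on C^8 + M_2 by
    word_map_id. *)
Lemma universal_isomorphic (U : cstarAlgType R) (A B C : U) :
  universal_cstar_algebra a b A B C ->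
  exists2 f : {lrmorphism U -> C8_M2 R}, star_isomorphism f &
    [/\ f A = gA, f B = gB & f C = gC].
Proof.
move=> [rel _ univ].
have [f [[fS fA fB fC] _]] := univ _ _ _ _ (generators_relations a0 b0 t01).
have [h [hS hA hB hC]] := word_hom_exists rel.
have [k [_ k_unique]] := univ _ _ _ _ rel.
exists f => //; split=> //; exists h => x.
- have e1 := k_unique (h \o f : {lrmorphism U -> U}).
  have e2 := k_unique (idfun : {lrmorphism U -> U}).
  transitivity (k x); last by rewrite -e2.
  rewrite -[LHS]/((h \o f) x) e1//; split=> [y| | |] /=.
  + by rewrite fS hS.
  + by rewrite fA.
  + by rewrite fB.
  + by rewrite fC.
- rewrite (word_hom_unique hS hA hB hC) word_map_natural// fA fB fC.
  exact: word_map_id.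
Qed.

End Universal.

(* Without 0 < t < 1 the matrices below are not projections, or generate a
   commutative algebra, and the isomorphism fails. *)
Theorem theorem4p7 (R : realType) (a b : R) (a_neq0 : a != 0) (b_neq0 : b != 0) :
  let t : R :=
    (b ^+ 2 + 2 * a ^+ 2 * b - a ^+ 2 * b ^+ 2 - a ^+ 2) / (4 * a ^+ 2 * b) in
  let s : R := Num.sqrt (t * (1 - t)) in
  let w : R := Num.sqrt (1 - 4 * a ^+ 2 / b ^+ 2 * (t * (1 - t))) in
  0 < t < 1 ->
  (exists (U : cstarAlgType R) (A B C : U), universal_cstar_algebra a b A B C) /\
  exists2 z : R, z = 1 / 2 + 1 / 2 * w \/ z = 1 / 2 - 1 / 2 * w &
    forall (U : cstarAlgType R) (A B C : U),
      universal_cstar_algebra a b A B C ->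
      exists2 f : {lrmorphism U -> C8_M2 R}, star_isomorphism f &
        [/\ f A = (1, 1, 1, 1, 0, 0, 0, 0, rmx2 1 0 0 0),
            f B = (1, 1, 0, 0, 1, 1, 0, 0, rmx2 t s s (1 - t))
          & f C = (1, 0, 1, 0, 1, 0, 1, 0,
                   rmx2 z (- (a / b) * s) (- (a / b) * s) (1 - z))].
Proof.
move=> t s w t01; split.
  by exists (C8_M2 R), (gen_A R), (gen_B a b), (gen_C a b); exact: C8_M2_universal.
exists (zparam a b); first exact: zparam_eq.
by move=> U A B C; exact: universal_isomorphic.
Qed.
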